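(* Let $\mathbf{F}$ be a field of characteristic $p>0$ and let $W$ be a finite subgroup of $(\mathbf{F},+)$, acting on $\mathbf{F}[V_2]=\mathbf{F}[x,y]$ by the algebra automorphisms determined by $x\cdot c=x$ and $y\cdot c=y+cx$ for $c\in W$. Let $N_W(y)=\prod_{c\in W}(y+cx)$. Then $\mathbf{F}[V_2]^W=\mathbf{F}[x,N_W(y)]$.
   Context: $V_2$ is the space of two-dimensional column vectors over $\mathbf{F}$ on which $c\in W$ acts by the matrix $\rho(c)=\begin{pmatrix}1&c\\0&1\end{pmatrix}$; $x=[0\;1]$ and $y=[1\;0]$ are elements of the dual $V_2^*$ (row vectors, with right action), and $\mathbf{F}[V_2]=\mathbf{F}[x,y]$ is the symmetric algebra on $V_2^*$. $\mathbf{F}[V_2]^W$ is the ring of invariants. *)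

(* Defs.v *)
From HB Require Import structures.
From mathcomp Require Import all_boot all_order all_algebra.
From mathcomp Require Export finmap.
From mathcomp Require Export mpoly.

Set Implicit Arguments.
Unset Strict Implicit.
Unset Printing Implicit Defensive.

Import GRing.Theory.

Local Open Scope ring_scope.

Section Invariants.
Variable F : fieldType.

(* F[V_2] = F[x, y], with x and y the variables of index 0 and 1. *)
Definition varx : {mpoly F[2]} := 'X_ord0.
Definition vary : {mpoly F[2]} := 'X_ord_max.

(* f . c, for the F-algebra endomorphism with x . c = x and y . c = y + c x. *)
Definition poly_act (c : F) (f : {mpoly F[2]}) : {mpoly F[2]} :=
  f \mPo [tuple varx; vary + c *: varx].

Definition W_invariant (W : {fset F}) (f : {mpoly F[2]}) : Prop :=
  forall c, c \in W -> poly_act c f = f.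

(* N_W(y) *)
Definition orbit_norm (W : {fset F}) : {mpoly F[2]} :=
  \prod_(c <- W) (vary + c *: varx).

(* Membership in the subalgebra F[a, b] of F[x, y]. *)
Definition in_subalg (a b f : {mpoly F[2]}) : Prop :=
  exists g : {mpoly F[2]}, f = g \mPo [tuple a; b].

(* The action is the one induced on the symmetric algebra of V_2^* by
   right multiplication by rho_mx c, where x = [0 1] and y = [1 0]. *)
Definition rho_mx (c : F) : 'M[F]_2 :=
  \matrix_(i, j) (if i == j then 1 else if (i < j)%N then c else 0).

Definition linear_form (v : 'rV[F]_2) : {mpoly F[2]} :=
  v 0 ord0 *: vary + v 0 ord_max *: varx.

Lemma poly_act_varx c : poly_act c varx = varx.
Proof. by rewrite /poly_act comp_mpolyXU. Qed.

Lemma poly_act_vary c : poly_act c vary = vary + c *: varx.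
Proof. by rewrite /poly_act comp_mpolyXU. Qed.

Lemma poly_act_linear_form c v :
  poly_act c (linear_form v) = linear_form (v *m rho_mx c).
Proof.
rewrite /linear_form {1}/poly_act comp_mpolyD !comp_mpolyZ -!/(poly_act c _).
rewrite poly_act_varx poly_act_vary !mxE !big_ord_recl !big_ord0 !mxE /=.
have -> : lift ord0 ord0 = ord_max :> 'I_2 by apply: val_inj.
by rewrite !mulr1 !mulr0 !addr0 scalerDr scalerDl scalerA addrA.
Qed.

Lemma poly_act0 f : poly_act 0 f = f.
Proof.
rewrite /poly_act -[RHS]comp_mpoly_id; congr (_ \mPo _); apply: eq_from_tnth => i.
rewrite tnth_mktuple (tnth_nth 0) /= scale0r addr0 /varx /vary.
by case: i => [[|[|//]]] lt_i /=; congr ('X_ _); apply: val_inj.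
Qed.

Lemma poly_actD c d f : poly_act (c + d) f = poly_act d (poly_act c f).
Proof.
rewrite /poly_act [LHS]comp_mpolyEX (comp_mpolyEX f) raddf_sum /=.
apply: eq_bigr => m _; rewrite comp_mpolyZ; congr (_ *: _).
rewrite !comp_mpolyX rmorph_prod; apply: eq_bigr => i _.
rewrite rmorphXn; congr (_ ^+ _); rewrite !(tnth_nth 0) /=.
case: i => [[|[|//]]] lt_i /=; first by rewrite comp_mpolyXU.
by rewrite comp_mpolyD comp_mpolyZ !comp_mpolyXU /= scalerDl (addrC (c *: _)) addrA.
Qed.

End Invariants.

(* Main.v *)
(** View F[x, y] as R[y] with R = F[x]. If P(y) is invariant under the
    translations y -> y + c x, then P(y) - P(0) vanishes at the |W| distinct
    points - c x of the domain R, so it is divisible by the monic polynomial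
    N_W(y) of degree |W|. The quotient is again invariant, because N_W(y) is
    invariant and can be cancelled, and one concludes by induction on the
    degree in y. *)
Require Import Defs.
From mathcomp Require Import all_boot all_order all_algebra.
Import GRing.Theory.
Local Open Scope ring_scope.

(** An injective self-map of a finite set is a bijection. This reindexes the products over the
    group. *)
Lemma perm_addl (V : zmodType) (s : seq V) (c : V) :
  uniq s -> {in s, forall d, c + d \in s} -> perm_eq [seq c + d | d <- s] s.
Proof.
move=> uniq_s cs_s.
have uniq_cs : uniq [seq c + d | d <- s] by rewrite map_inj_uniq //; exact: addrI.
have sub : {subset [seq c + d | d <- s] <= s} by move=> _ /mapP[d ds ->]; exact: cs_s.
have [|_ mem_eq] := uniq_min_size uniq_cs sub; first by rewrite size_map.
exact: uniq_perm.
Qed.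

(** * Translation-invariant univariate polynomials over a domain *)

Section TranslationInvariants.

Variables (R : idomainType) (s : seq R).
Hypotheses (uniq_s : uniq s) (s0 : 0 \in s).
Hypothesis sD : {in s &, forall c d, c + d \in s}.

Definition shift_prod : {poly R} := \prod_(c <- s) ('X + c%:P).

Lemma shift_prodE : shift_prod = \prod_(z <- [seq - c | c <- s]) ('X - z%:P).
Proof. by rewrite big_map; apply: eq_bigr => c _; rewrite polyCN opprK. Qed.

Lemma shift_prod_monic : shift_prod \is monic.
Proof. by rewrite shift_prodE monic_prod_XsubC. Qed.

Lemma size_shift_prod : size shift_prod = (size s).+1.
Proof. by rewrite shift_prodE size_prod_XsubC size_map. Qed.

Lemma shift_prod_translate c :
  c \in s -> shift_prod \Po ('X + c%:P) = shift_prod.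
Proof.
move=> cs; rewrite /shift_prod rmorph_prod /=.
rewrite -[RHS](perm_big _ (perm_addl _ _ _ uniq_s (fun d => sD _ _ cs))) big_map.
by apply: eq_bigr => d _; rewrite comp_polyD comp_polyX comp_polyC polyCD addrA.
Qed.

Lemma shift_prod_dvd (P : {poly R}) :
  {in s, forall c, P.[- c] = 0} -> exists Q, P = Q * shift_prod.
Proof.
move=> rootP; have monicN := shift_prod_monic.
exists (Pdiv.CommonRing.rdivp P shift_prod).
have divP := Pdiv.RingMonic.rdivp_eq monicN P.
set r := Pdiv.CommonRing.rmodp P shift_prod in divP.
suff r0 : r = 0 by rewrite {1}divP r0 addr0.
apply/eqP; apply: contraT => r_neq0.
have size_r : (size r < size shift_prod)%N.
  by rewrite Pdiv.CommonRing.ltn_rmodpN0 ?monic_neq0.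
(* A nonzero [r] has more coefficients than distinct roots. It vanishes at every [- c], as both [P]
   and [shift_prod] do, while its degree is below [size s]. *)
have : (size s < size r)%N.
  rewrite -(size_map -%R s); apply: max_poly_roots r_neq0 _ _.
    apply/allP => _ /mapP[c cs ->]; rewrite /root.
    have rootN : shift_prod.[- c] = 0.
      apply/eqP; rewrite -/(root _ _) shift_prodE root_prod_XsubC.
      by rewrite map_f.
    by rewrite -[X in _ == X](rootP c cs) divP hornerD hornerM rootN mulr0 add0r.
  by rewrite map_inj_uniq //; exact: oppr_inj.
by move: size_r; rewrite size_shift_prod ltnS leqNgt => /negP.
Qed.

Lemma translation_invariant_comp (P : {poly R}) :
  {in s, forall c, P \Po ('X + c%:P) = P} -> exists G, P = G \Po shift_prod.
Proof.
have [n] := ubnP (size P); elim: n P => // n IHn P size_P invP.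
have [Q eqQ] : exists Q, P - (P.[0])%:P = Q * shift_prod.
  apply: shift_prod_dvd => c cs.
  (* Evaluating the invariance under [c] at [- c] gives P(0) = P(- c). *)
  have /(congr1 (fun p => p.[- c])) := invP c cs.
  rewrite horner_comp !hornerE addNr => <-.
  by rewrite subrr.
have divP : P = Q * shift_prod + (P.[0])%:P by rewrite -eqQ subrK.
have [Q0|Q_neq0] := eqVneq Q 0.
  by exists (P.[0])%:P; rewrite comp_polyC {1}divP Q0 mul0r add0r.
have N_neq0 : shift_prod != 0 by rewrite monic_neq0 // shift_prod_monic.
have [||G eqG] := IHn Q.
- have s_gt0 : (0 < size s)%N by case: (s) s0.
  have size_QN : size (Q * shift_prod) = (size Q + size s)%N.
    by rewrite size_Mmonic ?shift_prod_monic // size_shift_prod addnS.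
  (* The product has size at least 2, so adding the constant P(0) does not change its size, and [Q]
     is strictly smaller than [P]. *)
  rewrite -ltnS; apply: leq_trans size_P; rewrite ltnS divP size_polyDl size_QN.
    by rewrite -[X in (X < _)%N]addn0 ltn_add2l.
  apply: leq_ltn_trans (size_polyC_leq1 _) _.
  by apply: (@leq_add 1 1) => //; rewrite size_poly_gt0.
(* With t the translation by [c] and N the product, (Q o t) N = (Q N) o t = (P - P(0)) o t = P -
   P(0) = Q N. *)
- move=> c cs; apply: (mulIf N_neq0).
  rewrite -{1}(shift_prod_translate _ cs) -comp_polyM -eqQ.
  by rewrite comp_polyB comp_polyC invP.
by exists (G * 'X + (P.[0])%:P); rewrite comp_polyD comp_polyM comp_polyX comp_polyC -eqG.
Qed.

End TranslationInvariants.

(** Ring morphisms need not be F-linear, so agreement on scalars is required along with agreement on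
    the two variables. *)
Lemma mpoly2_rmorph_ext (F : fieldType) (S : comNzRingType)
    (f g : {rmorphism {mpoly F[2]} -> S}) :
  (forall a, f a%:MP = g a%:MP) -> f (varx F) = g (varx F) ->
  f (vary F) = g (vary F) -> f =1 g.
Proof.
move=> eqC eqx eqy p; rewrite [p]mpolyE !rmorph_sum; apply: eq_bigr => m _.
rewrite -mul_mpolyC !rmorphM eqC; congr (_ * _).
rewrite mpolyXE_id !rmorph_prod; apply: eq_bigr => i _; rewrite !rmorphXn.
congr (_ ^+ _); case: i => [[|[|//]]] lt_i.
  by rewrite (_ : Ordinal lt_i = ord0) //; apply: val_inj.
by rewrite (_ : Ordinal lt_i = ord_max) //; apply: val_inj.
Qed.

(** * Identification of F[x, y] with F[x][y] *)

Section Bivariate.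

Variable F : fieldType.

(** The outer variable is y and the inner one is x, so that the action of [c] becomes a translation
    by the coefficient c x. *)
Definition to_poly2 : {rmorphism {mpoly F[2]} -> {poly {poly F}}} :=
  mmap (polyC \o polyC) (tnth [tuple 'X%:P; 'X]).

Definition to_mpolyx : {rmorphism {poly F} -> {mpoly F[2]}} :=
  horner_eval (varx F) \o map_poly (@mpolyC 2 F).

Definition to_mpoly : {rmorphism {poly {poly F}} -> {mpoly F[2]}} :=
  horner_eval (vary F) \o map_poly to_mpolyx.

Lemma to_poly2C a : to_poly2 a%:MP = a%:P%:P.
Proof. by rewrite /= mmapC. Qed.

Lemma to_poly2x : to_poly2 (varx F) = 'X%:P.
Proof. by rewrite /= mmapX mmap1U. Qed.

Lemma to_poly2y : to_poly2 (vary F) = 'X.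
Proof. by rewrite /= mmapX mmap1U. Qed.

Lemma to_mpolyxE q : to_mpolyx q = (map_poly (@mpolyC 2 F) q).[varx F].
Proof. by []. Qed.

Lemma to_mpolyE P : to_mpoly P = (map_poly to_mpolyx P).[vary F].
Proof. by []. Qed.

Lemma to_mpolyC q : to_mpoly q%:P = to_mpolyx q.
Proof. by rewrite to_mpolyE map_polyC hornerC. Qed.

Lemma to_mpolyxC a : to_mpolyx a%:P = a%:MP.
Proof. by rewrite to_mpolyxE map_polyC hornerC. Qed.

Lemma to_mpolyxX : to_mpolyx 'X = varx F.
Proof. by rewrite to_mpolyxE map_polyX hornerX. Qed.

Lemma to_mpolyX : to_mpoly 'X = vary F.
Proof. by rewrite to_mpolyE map_polyX hornerX. Qed.

Lemma to_poly2K : cancel to_poly2 to_mpoly.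
Proof.
apply: (mpoly2_rmorph_ext _ _ (to_mpoly \o to_poly2) idfun) => [a||].
- by rewrite -[LHS]/(to_mpoly (to_poly2 _)) to_poly2C to_mpolyC to_mpolyxC.
- by rewrite -[LHS]/(to_mpoly (to_poly2 _)) to_poly2x to_mpolyC to_mpolyxX.
- by rewrite -[LHS]/(to_mpoly (to_poly2 _)) to_poly2y to_mpolyX.
Qed.

Lemma to_poly2_act c f :
  to_poly2 (poly_act c f) = to_poly2 f \Po ('X + (c *: 'X)%:P).
Proof.
pose act := comp_mpoly [tuple varx F; vary F + c *: varx F].
pose tr := comp_poly ('X + (c *: 'X)%:P : {poly {poly F}}).
have actE p : (to_poly2 \o act) p = to_poly2 (poly_act c p) by [].
have trE p : (tr \o to_poly2) p = to_poly2 p \Po ('X + (c *: 'X)%:P) by [].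
apply: (mpoly2_rmorph_ext _ _ (to_poly2 \o act) (tr \o to_poly2)) => [a||];
  rewrite [LHS]actE [RHS]trE.
- by rewrite /poly_act comp_mpolyC to_poly2C comp_polyC.
- by rewrite poly_act_varx to_poly2x comp_polyC.
- rewrite poly_act_vary to_poly2y comp_polyX rmorphD to_poly2y.
  by rewrite -mul_mpolyC rmorphM to_poly2C to_poly2x -polyCM mul_polyC.
Qed.

(** Substituting for y alone leaves the coefficients in F[x] fixed. This turns a polynomial in N
    over F[x] into an element of F[x, N]. *)
Lemma to_mpoly_comp G N :
  to_mpoly (G \Po N) = to_mpoly G \mPo [tuple varx F; to_mpoly N].
Proof.
pose h : {rmorphism {mpoly F[2]} -> {mpoly F[2]}} :=
  comp_mpoly [tuple varx F; to_mpoly N].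
have hE p : p \mPo [tuple varx F; to_mpoly N] = h p by [].
have hC a : h a%:MP = a%:MP by rewrite -hE comp_mpolyC.
have hx : h (varx F) = varx F by rewrite -hE comp_mpolyXU.
have hy : h (vary F) = to_mpoly N by rewrite -hE comp_mpolyXU.
have h_mpolyx q : h (to_mpolyx q) = to_mpolyx q.
  rewrite !to_mpolyxE -horner_map hx -map_poly_comp.
  by congr (_.[_]); apply: eq_map_poly => a; exact: hC.
rewrite hE [in LHS]to_mpolyE map_comp_poly horner_comp -[X in _.[X]]to_mpolyE.
rewrite [in RHS]to_mpolyE -horner_map hy -map_poly_comp.
by congr (_.[_]); apply/esym/eq_map_poly => q; exact: h_mpolyx.
Qed.

End Bivariate.

(** * The invariant ring *)

Lemma poly_act_orbit_norm (F : fieldType) (W : {fset F}) (c : F) :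
  {in W, forall d, c + d \in W} -> poly_act c (orbit_norm W) = orbit_norm W.
Proof.
move=> cW; rewrite /poly_act /orbit_norm rmorph_prod /=.
rewrite -[RHS](perm_big _ (perm_addl _ _ _ (fset_uniq W) cW)) big_map.
apply: eq_bigr => d _; rewrite comp_mpolyD comp_mpolyZ !comp_mpolyXU /=.
by rewrite scalerDl addrA.
Qed.

(** Substituting [a], [b] and then acting by [c] is a ring morphism. It agrees with the substitution
    alone on scalars and on both variables. *)
Lemma poly_act_subalg (F : fieldType) (c : F) (a b f : {mpoly F[2]}) :
  poly_act c a = a -> poly_act c b = b -> in_subalg a b f -> poly_act c f = f.
Proof.
move=> ca cb [g ->]; pose h := comp_mpoly [tuple a; b].
pose act := comp_mpoly [tuple varx F; vary F + c *: varx F].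
have actE q : (act \o h) q = poly_act c (h q) by [].
apply: (mpoly2_rmorph_ext _ _ (act \o h) h) => [k||]; rewrite [LHS]actE -[RHS]/(h _).
- have -> : h k%:MP = k%:MP by exact: comp_mpolyC.
  exact: comp_mpolyC.
- by rewrite /h comp_mpolyXU.
- by rewrite /h comp_mpolyXU.
Qed.

Theorem proposition3p2 (F : fieldType) (p : nat) (W : {fset F})
  (charF : p \in [pchar F]) (subgroupW : zmod_closed (mem W)) :
  forall f : {mpoly F[2]},
    W_invariant W f <-> in_subalg (varx F) (orbit_norm W) f.
Proof.
have [W0 WB] := subgroupW.
have WD : {in W &, forall c d, c + d \in W}.
  move=> c d cW dW; rewrite -[d]opprK; apply: (WB) => //.
  by rewrite -[- d]add0r; apply: (WB).
move=> f; split=> [invf | subf c cW]; last first.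
  apply: poly_act_subalg subf; first exact: poly_act_varx.
  by apply: poly_act_orbit_norm => d; exact: WD.
(* The copy W x of W inside F[x], which is the group of translations of y. *)
pose s := [seq c *: 'X | c <- W].
have [||||G eqG] := translation_invariant_comp _ s _ _ _ (to_poly2 F f).
(* The coefficient of x recovers c from c x. *)
- rewrite map_inj_uniq ?fset_uniq // => c d /(congr1 (coefp 1)).
  by rewrite /= !coefZ coefX !mulr1.
- by apply/mapP; exists 0; rewrite ?scale0r.
- move=> _ _ /mapP[c cW ->] /mapP[d dW ->]; rewrite -scalerDl.
  by apply: (map_f (fun e => e *: 'X)); exact: WD.
- by move=> _ /mapP[c cW ->]; rewrite -to_poly2_act invf.
exists (to_mpoly F G); rewrite -[LHS]to_poly2K eqG to_mpoly_comp.
congr (_ \mPo [tuple _; _]).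
(* It remains to see that [to_mpoly] carries [shift_prod] to the orbit norm, factor by factor. *)
rewrite /shift_prod big_map rmorph_prod; apply: eq_bigr => c _.
rewrite rmorphD to_mpolyX to_mpolyC -mul_polyC rmorphM to_mpolyxC to_mpolyxX.
by rewrite mul_mpolyC.
Qed.
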